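(* Let $p$ be an odd prime, let $G$ be a (finite) nonsplit metacyclic $p$-group, let $N$ be a subgroup of $G$ of index $p$, and let $x$ be any element of $G\setminus N$. Then the Haar graph $H(G,N\cup\{x\})$ is a Cayley graph which is not algebraically Cayley.
   Context: All groups and graphs are finite and graphs are undirected. A group $G$ is metacyclic if it has a cyclic normal subgroup $C$ with $G/C$ cyclic; it is split metacyclic if it has a cyclic normal subgroup $C$ and a cyclic subgroup $K$ with $G=CK$ and $C\cap K=1$ (i.e. $G$ is a semidirect product of cyclic groups), and nonsplit metacyclic if it is metacyclic but not split metacyclic. For a group $G$ and an arbitrary subset $S\subseteq G$, the Haar graph $H(G,S)$ is the graph with vertex set $G\times\{0,1\}$ and edges $[(x,0),(sx,1)]$ for $x\in G$, $s\in S$. For a group $A$ and $T\subseteq A$ with $1_A\notin T$ and $T=T^{-1}$, the Cayley graph $\mathrm{Cay}(A,T)$ has vertex set $A$ and edges $[x,tx]$ for $x\in A$, $t\in T$. A graph $X$ is called a Cayley graph if it is isomorphic to some $\mathrm{Cay}(A,T)$ (equivalently, $\operatorname{Aut} X$ contains a subgroup acting regularly on the vertex set). For $g\in G$ let $g_R$ be the permutation of $G\times\{0,1\}$ given by $(x,i)^{g_R}=(xg,i)$, and let $G_R=\{g_R: g\in G\}\le \operatorname{Aut} H(G,S)$. The Haar graph $X=H(G,S)$ is called algebraically Cayley if there is a subgroup $A\le\operatorname{Aut} X$ with $G_R\le A$ such that $A$ acts regularly on the vertex set $V(X)$. *)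

(* Defs.v *)
From HB Require Import structures.
From mathcomp Require Import all_boot all_fingroup all_solvable.

Set Implicit Arguments.
Unset Strict Implicit.
Unset Printing Implicit Defensive.

Local Open Scope group_scope.

Definition split_metacyclic (gT : finGroupType) (G : {group gT}) : Prop :=
  exists C K : {group gT}, [/\ cyclic C, cyclic K & C ><| K = G].

Definition nonsplit_metacyclic (gT : finGroupType) (G : {group gT}) : Prop :=
  metacyclic G /\ ~ split_metacyclic G.

(* An undirected graph on V is given by its symmetric adjacency relation. *)

Definition graph_isomorphic (V W : finType) (e : rel V) (f : rel W) : Prop :=
  exists2 h : V -> W, bijective h & forall u v, f (h u) (h v) = e u v.

Section Automorphisms.

Variables (V : finType) (e : rel V).

Definition graph_Aut : {set {perm V}} :=
  [set s : {perm V} | [forall u, forall v, e (s u) (s v) == e u v]].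

Lemma graph_AutP (s : {perm V}) :
  reflect (forall u v, e (s u) (s v) = e u v) (s \in graph_Aut).
Proof.
rewrite inE; apply: (iffP 'forall_forallP) => es u v; last exact/eqP.
exact/eqP/es.
Qed.

Lemma group_set_graph_Aut : group_set graph_Aut.
Proof.
apply/group_setP; split=> [|s t /graph_AutP es /graph_AutP et]; apply/graph_AutP.
  by move=> u v; rewrite !perm1.
by move=> u v; rewrite !permM et es.
Qed.

Canonical graph_Aut_group := Group group_set_graph_Aut.

End Automorphisms.

Definition regular (V : finType) (A : {group {perm V}}) : Prop :=
  [transitive A, on [set: V] | 'P] /\ (forall v : V, 'C_A[v | 'P] = 1).

Definition cayley_edge (aT : finGroupType) (T : {set aT}) : rel aT :=
  fun x y => [exists t in T, y == t * x].

(* T^-1 is the setwise inverse [set t^-1 | t in T]. *)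
Definition is_cayley_graph (V : finType) (e : rel V) : Prop :=
  exists (aT : finGroupType) (T : {set aT}),
    [/\ 1 \notin T, T^-1 = T & graph_isomorphic e (cayley_edge T)].

Section HaarGraph.

Variable gT : finGroupType.

(* The group is the whole type gT; the layers G x {0} and G x {1} are the
   vertices with second component false and true. *)
Definition haar_arc (S : {set gT}) : rel (gT * bool) :=
  fun u v => [&& ~~ u.2, v.2 & [exists s in S, v.1 == s * u.1]].

Definition haar_edge (S : {set gT}) : rel (gT * bool) :=
  fun u v => haar_arc S u v || haar_arc S v u.

Definition right_transl_fun (g : gT) (u : gT * bool) : gT * bool :=
  (u.1 * g, u.2).

Lemma right_transl_inj (g : gT) : injective (right_transl_fun g).
Proof. by move=> [x i] [y j] [/mulIg-> ->]. Qed.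

Definition right_transl (g : gT) : {perm gT * bool} := perm (@right_transl_inj g).

Definition right_transls : {set {perm gT * bool}} :=
  [set right_transl g | g : gT].

Lemma right_translM (g h : gT) :
  right_transl (g * h) = right_transl g * right_transl h.
Proof. by apply/permP=> u; rewrite permM !permE /right_transl_fun /= mulgA. Qed.

Lemma group_set_right_transls : group_set right_transls.
Proof.
apply/group_setP; split=> [|_ _ /imsetP[g _ ->] /imsetP[h _ ->]].
  apply/imsetP; exists 1 => //; apply/permP=> -[x i].
  by rewrite perm1 permE /right_transl_fun /= mulg1.
by rewrite -right_translM imset_f.
Qed.

Canonical right_transls_group := Group group_set_right_transls.

Lemma right_transls_Aut (S : {set gT}) :
  right_transls \subset graph_Aut (haar_edge S).
Proof.
have arcE g u v : haar_arc S (right_transl g u) (right_transl g v) = haar_arc S u v.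
  rewrite /haar_arc !permE /=; do 2!congr (_ && _).
  by apply: eq_existsb => s; rewrite mulgA (inj_eq (mulIg g)).
apply/subsetP=> _ /imsetP[g _ ->]; apply/graph_AutP=> u v.
by rewrite /haar_edge !arcE.
Qed.

Definition algebraically_cayley (S : {set gT}) : Prop :=
  exists A : {group {perm gT * bool}},
    [/\ A \subset graph_Aut (haar_edge S), right_transls \subset A & regular A].

End HaarGraph.

(* Main.v *)
Require Import Defs.
From HB Require Import structures.
From mathcomp Require Import all_boot all_fingroup all_solvable.

(** Write S = N :|: [set x], where N is normal of index p.

    The graph is Cayley because it depends only on p and #|N|: each coset of N
    contributes a complete bipartite graph on its two layers, and the edges
    [(g, 0), (x g, 1)] form perfect matchings that tie these p blocks into a
    ring.  The layers of a complete bipartite block may be relabelled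
    independently, so each matching can be made to preserve the labels in N.
    The ring is then a Cayley graph on D x N, where D is the dihedral group on
    G / N: the reflection given by the coset of x yields, with arbitrary labels
    in N, the complete blocks, and the reflection given by the trivial coset
    yields the matchings ([haar_cayley]).

    Suppose now that a regular group A of automorphisms contains the right
    translations R.  Then R has index 2 in A, hence is normal, and since #|R|
    is odd, A = R <t> for an involution t.  If t centralised R, it would be
    (g, 0) <-> (c g, 1) for some c, and preserving edges means that S is stable
    under s |-> c s^-1 c; modulo N this fails, because G / N has odd order
    ([haar_set_not_twist_stable]).  So R, a copy of G, has a nontrivial
    automorphism of order 2, and G is split by the main group-theoretic fact
    ([metacyclic_involution_split]): for p odd, a metacyclic p-group G with a
    nontrivial automorphism t of order 2 is split.

    To prove that fact, note that G is generated by two elements, each of which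
    t fixes or inverts ([two_generators_fix_or_inv]): elements fixed or
    inverted by t exist outside every proper subgroup, and G / Phi(G) has order
    at most p^2.  They are not both fixed.  Two properties of a metacyclic
    p-group are used: G' is cyclic, so that t fixes or inverts it and G' is
    generated by the commutator of the two generators; and every element of G'
    is a p-th power in G.
    - If both generators a, b are inverted, the action of t on [a, b] shows
      that t fixes G' and that G' is central.  Writing [a, b] = c^p, with
      c inverted modulo G', forces [a, b]^2 to be a p-th power in G', so
      G' = 1: G is abelian, generated by two elements, and splits.
    - If a is inverted and w is fixed, t inverts M = <a> G', which is therefore
      abelian and meets <w> trivially, and G = M ><| <w>.  For m in M and u in
      <w>, the power (m u)^p is u^p modulo Phi(M), so it lies in Phi(M) as soon
      as it lies in M.  Elements of G' are such powers, so G' is contained in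
      Phi(M).  Hence M = <a> is cyclic and the decomposition splits G. *)

Set Implicit Arguments.
Unset Strict Implicit.
Unset Printing Implicit Defensive.

Local Open Scope group_scope.

(** * Involutions acting on groups of odd order *)

Lemma pgroup_odd_order (gT : finGroupType) (p : nat) (G : {group gT}) (y : gT) :
  odd p -> p.-group G -> y \in G -> odd #[y].
Proof.
move=> odd_p pG Gy; have /p_natP[n ->] := mem_p_elt pG Gy.
by rewrite oddX odd_p orbT.
Qed.

Lemma conjg_sqr1K (gT : finGroupType) (t y : gT) :
  t ^+ 2 = 1 -> (y ^ t) ^ t = y.
Proof. by move=> t2; rewrite -conjgM -[t * t]/(t ^+ 2) t2 conjg1. Qed.

Lemma odd_sqr_mem (gT : finGroupType) (H : {group gT}) (a : gT) :
  odd #[a] -> a ^+ 2 \in H -> a \in H.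
Proof.
move=> odd_a Ha2; have -> : a = (a ^+ 2) ^+ (#[a].+1)./2; last exact: groupX.
by rewrite -expgM mul2n even_halfK /= ?odd_a // expgSr expg_order mul1g.
Qed.

(** An odd power of h inverts z as well, and some odd power of h is trivial. *)
Lemma conj_inv_odd_eq1 (gT : finGroupType) (h z : gT) :
  odd #[h] -> odd #[z] -> z ^ h = z^-1 -> z = 1.
Proof.
move=> odd_h odd_z zh.
have zhX n : z ^ (h ^+ n) = if odd n then z^-1 else z.
  elim: n => [|n IHn]; first by rewrite conjg1.
  by rewrite expgSr conjgM IHn /=; case: odd; rewrite ?conjVg zh ?invgK.
have: z ^ (h ^+ #[h]) = z^-1 by rewrite zhX odd_h.
rewrite expg_order conjg1 => zV.
have: #[z] %| 2 by rewrite order_dvdn expgS expg1 {2}zV mulgV.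
rewrite dvdn_divisors // !inE order_eq1 => /orP[/eqP// | /eqP oz].
by rewrite oz in odd_z.
Qed.

Lemma sqr_eq1_odd (gT : finGroupType) (z : gT) : odd #[z] -> z = z^-1 -> z = 1.
Proof.
move=> odd_z zV; apply: (@conj_inv_odd_eq1 _ 1) => //; first by rewrite order1.
by rewrite conjg1.
Qed.

(** The elements z^-1 z^t, inverted by t, and z z^t, fixed by t, generate comparable
    subgroups of <[z]>, so the one in the other's subgroup is both inverted and
    fixed, hence trivial. *)
Lemma involution_cyclic_pgroup (gT : finGroupType) (p : nat) (t z : gT) :
    odd p -> p.-elt z -> t ^+ 2 = 1 -> t \in 'N(<[z]>) ->
  z ^ t = z^-1 \/ z ^ t = z.
Proof.
move=> odd_p pz t2 nzt.
have ztz : z ^ t \in <[z]> by rewrite memJ_norm ?cycle_id.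
have ztt := conjg_sqr1K z t2.
have cz : commute z (z ^ t).
  by apply/esym/cent1P; rewrite -cent_cycle (subsetP (cycle_abelian z)).
have odd_elt y : y \in <[z]> -> odd #[y] := pgroup_odd_order odd_p pz.
set u := z^-1 * z ^ t; set v := z * z ^ t.
have zu : u \in <[z]> by rewrite /u groupM ?groupV ?cycle_id.
have zv : v \in <[z]> by rewrite /v groupM ?cycle_id.
have ut : u ^ t = u^-1 by rewrite /u conjMg conjVg ztt [RHS]invgM invgK.
have vt : v ^ t = v by rewrite /v conjMg ztt -cz.
have: (<[u]> \subset <[v]>) || (<[v]> \subset <[u]>).
  have sub_dvd x y : x \in <[z]> -> y \in <[z]> ->
      (<[x]> \subset <[y]>) = (#[x] %| #[y]).
    by move=> zx zy; rewrite -(cardSg_cyclic (cycle_cyclic z)) ?cycle_subG.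
  have /p_natP[i oi]: p.-elt u by apply: mem_p_elt zu.
  have /p_natP[j oj]: p.-elt v by apply: mem_p_elt zv.
  rewrite !sub_dvd // oi oj; case/orP: (leq_total i j) => le_ij.
    by rewrite dvdn_exp2l.
  by rewrite orbC dvdn_exp2l.
rewrite !cycle_subG => /orP[/cycleP[i ui] | /cycleP[i vi]]; [right | left].
  have u1 : u = 1.
    by apply: sqr_eq1_odd; rewrite ?odd_elt // -ut ui conjXg vt.
  by apply: (mulgI z^-1); rewrite -/u u1 mulVg.
have v1 : v = 1.
  by apply: sqr_eq1_odd; rewrite ?odd_elt // -{1}vt vi conjXg ut expgVn.
by apply: (mulgI z); rewrite -/v v1 mulgV.
Qed.

(** Elements y^-1 y^t are inverted; if they all lie in a maximal subgroup M
    containing D, then t acts trivially on G / M and each coset of M contains a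
    fixed point. *)
Lemma invol_fix_or_inv_notin (gT : finGroupType) (p : nat)
    (G D : {group gT}) (t : gT) :
    odd p -> p.-group G -> t ^+ 2 = 1 -> t \in 'N(G) -> D \proper G ->
  exists2 e, e \in G :\: D & e ^ t = e^-1 \/ e ^ t = e.
Proof.
move=> odd_p pG t2 nGt prDG.
have [M maxM sDM] : {M : {group gT} | maximal M G & D \subset M}.
  by apply: maxgroup_exists.
have /andP[sMG nMG] := p_maximal_normal pG maxM.
have [_ [g Gg notMg]] := properP (maxgroupp maxM).
have GJ y : y \in G -> y ^ t \in G by move=> Gy; rewrite memJ_norm.
case: (pickP [pred y in G | y^-1 * y ^ t \notin M])
  => [y /andP[/= Gy notMy] | allM].
  exists (y^-1 * y ^ t).
    apply/setDP; split; first by rewrite groupM ?groupV ?GJ.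
    by apply: contra notMy; apply: (subsetP sDM).
  by left; rewrite conjMg conjVg conjg_sqr1K // [RHS]invgM invgK.
have commM y : y \in G -> y^-1 * y ^ t \in M.
  by move=> Gy; move/(_ y)/negbT: allM; rewrite /= Gy negbK.
(* Otherwise t stabilises the cosets of M, and it fixes a point of any of them
   since these have odd size. *)
have stab : [acts <[t]>, on g *: M | 'J].
  rewrite cycle_subG; apply/astabsP => y /=.
  suff sub z : z \in g *: M -> z ^ t \in g *: M.
    apply/idP/idP => [/sub | /sub //].
    by rewrite conjg_sqr1K.
  rewrite !mem_lcoset => Mz.
  have Gz : z \in G by rewrite -(mulKVg g z) groupM // (subsetP sMG).
  by rewrite -(mulKVg z (z ^ t)) mulgA groupM ?commM.
have t2group : 2.-group <[t]>.
  by rewrite /pgroup -orderE (@pnat_dvd _ 2) // order_dvdn t2.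
have := pgroup_fix_mod t2group stab.
rewrite card_lcoset !modn2.
have /p_natP[n ->] : p.-group M by apply: pgroupS pG.
rewrite oddX odd_p orbT.
case: (set_0Vmem 'Fix_(g *: M | 'J)(<[t]>)) => [-> | [e]].
  by rewrite cards0.
case/setIP => gMe /afixP/(_ t (cycle_id t)) /= et _.
exists e; last by right.
rewrite inE; apply/andP; split.
  apply: contra notMg => De; rewrite mem_lcoset in gMe.
  by rewrite -groupV -(mulgK e g^-1) groupM // groupV (subsetP sDM).
by rewrite mem_lcoset in gMe; rewrite -(mulKVg g e) groupM // (subsetP sMG).
Qed.

(** * Metacyclic p-groups *)

Lemma metacyclic_mul_cyclesP (gT : finGroupType) (G : {group gT}) :
  reflect (exists c g, [/\ c \in G, g \in G, G \subset 'N(<[c]>)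
                         & <[c]> * <[g]> = G])
          (metacyclic G).
Proof.
apply: (iffP metacyclicP).
  case=> C [/cyclicP[c ->] /andP[sCG nCG] /cyclicP[gbar defGb]].
  have /morphimP[g nCg Gg defgb] : gbar \in G / <[c]>
    by rewrite defGb cycle_id.
  exists c, g; have Gc : c \in G by rewrite -cycle_subG.
  split=> //.
  apply/eqP; rewrite eqEsubset mul_subG ?cycle_subG //=.
  by rewrite -quotientSK // defGb quotient_cycle // -defgb.
move=> [c [g [Gc Gg nCG defG]]]; exists <[c]>%G; split; first exact: cycle_cyclic.
  by rewrite /normal cycle_subG Gc.
by rewrite -defG quotientMidl quotient_cyclic ?cycle_cyclic.
Qed.

Lemma metacyclic_cyclic_der1 (gT : finGroupType) (G : {group gT}) :
  metacyclic G -> cyclic G^`(1).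
Proof.
case/metacyclicP=> C [cycC /andP[_ nCG] cycGC].
by apply: cyclicS cycC; rewrite der1_min ?cyclic_abelian.
Qed.

Lemma morphim_metacyclic (aT rT : finGroupType) (D G : {group aT})
    (f : {morphism D >-> rT}) :
  G \subset D -> metacyclic G -> metacyclic (f @* G).
Proof.
move=> sGD /metacyclic_mul_cyclesP[c [g [Gc Gg nCG defG]]].
have [Dc Dg] := (subsetP sGD c Gc, subsetP sGD g Gg).
apply/metacyclic_mul_cyclesP; exists (f c), (f g).
rewrite !mem_morphim // -!morphim_cycle //; split=> //.
  exact: morphim_norms.
by rewrite -morphimMl ?cycle_subG // defG.
Qed.

Lemma prime_order_normal_central (gT : finGroupType) (p : nat) (P : {group gT})
    (z : gT) :
    prime p -> p.-group P -> z \in P -> P \subset 'N(<[z]>) -> z ^+ p = 1 ->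
  P \subset 'C[z].
Proof.
move=> p_pr pP Pz nzP zp.
have [-> | nt_z] := eqVneq z 1; first by rewrite cent11T subsetT.
have oz : #[z] = p by apply: nt_prime_order.
rewrite -cent_cycle centsC (subset_trans _ (subsetIr P 'C(P))) //.
rewrite (@prime_meetG _ <[z]> 'Z(P)) -?orderE ?oz //.
apply: (meet_center_nil (pgroup_nil pP)).
  by rewrite /normal cycle_subG Pz.
by rewrite cycle_eq1.
Qed.

(** With <[c]> normal and G = <[c]> <[g]>, the image of <[c]> modulo <[c ^+ p]> has
    order 1 or p, hence is central: G / <[c ^+ p]> is abelian. *)
Lemma metacyclic_der1_expg (gT : finGroupType) (p : nat) (G : {group gT}) (z : gT) :
    prime p -> p.-group G -> metacyclic G -> z \in G^`(1) ->
  exists2 c, c \in G & z = c ^+ p.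
Proof.
move=> p_pr pG /metacyclic_mul_cyclesP[c [g [Gc Gg nCG defG]]].
have nPG : G \subset 'N(<[c ^+ p]>).
  by rewrite (char_norm_trans _ nCG) ?sub_cyclic_char ?cycle_cyclic ?cycleX.
suffices /subsetP sG'P : G^`(1) \subset <[c ^+ p]>.
  move=> /sG'P/cycleP[i ->]; exists (c ^+ i); first exact: groupX.
  by rewrite -!expgM mulnC.
have [nPc nPg] := (subsetP nPG c Gc, subsetP nPG g Gg).
apply: der1_min => //; rewrite -defG quotientMl ?cycle_subG //.
rewrite !quotient_cycle // abelianM !cycle_abelian cent_cycle cycle_subG /=.
apply: subsetP (mem_quotient _ Gg).
apply: (prime_order_normal_central p_pr); rewrite ?quotient_pgroup ?mem_quotient //.
  by rewrite -quotient_cycle // quotient_norms.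
by rewrite -morphX //= coset_id ?cycle_id.
Qed.

Lemma metacyclic_card_Phi (gT : finGroupType) (p : nat) (G : {group gT}) :
  prime p -> p.-group G -> metacyclic G -> #|G / 'Phi(G)| <= p ^ 2.
Proof.
move=> p_pr pG /metacyclic_mul_cyclesP[c [g [Gc Gg nCG defG]]].
have /andP[_ nFG] := Phi_normal G.
have [abelG expG] := abelemP p_pr (Phi_quotient_abelem pG).
have le_p y : y \in G -> #|<[y]> / 'Phi(G)| <= p.
  move=> Gy; rewrite quotient_cycle ?(subsetP nFG) // -orderE.
  by rewrite dvdn_leq ?prime_gt0 // order_dvdn expG ?mem_quotient.
have defGb : G / 'Phi(G) = (<[c]> / 'Phi(G)) * (<[g]> / 'Phi(G)).
  by rewrite -quotientMl ?cycle_subG ?(subsetP nFG) ?defG.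
rewrite defGb (leq_trans _ (leq_mul (le_p c Gc) (le_p g Gg))) //.
by rewrite mul_cardG leq_pmulr ?cardG_gt0.
Qed.

(** As G' is cyclic, <[[~ a, b]]> is normal in G, and modulo it a and b commute. *)
Lemma der1_two_generated (gT : finGroupType) (G : {group gT}) (a b : gT) :
    <[a]> <*> <[b]> = G -> cyclic G^`(1) -> G^`(1) = <[[~ a, b]]>.
Proof.
move=> defG cycG'.
have sabG : <[a]> <*> <[b]> \subset G by rewrite defG.
move: (sabG); rewrite join_subG !cycle_subG => /andP[Ga Gb].
have G'z : [~ a, b] \in G^`(1) by rewrite mem_commg.
have nzG : G \subset 'N(<[[~ a, b]]>).
  apply: (char_norm_trans _ (der_norm 1 G)).
  by rewrite sub_cyclic_char ?cycle_subG.
have [nza nzb] := (subsetP nzG a Ga, subsetP nzG b Gb).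
apply/eqP; rewrite eqEsubset cycle_subG G'z andbT der1_min //.
rewrite -{1}defG quotientY ?cycle_subG // !quotient_cycle // abelianY.
rewrite !cycle_abelian cent_cycle cycle_subG /=.
apply/cent1P/commgP/eqP; rewrite -invg_comm -morphR //=.
by rewrite coset_id ?cycle_id ?invg1.
Qed.

(** The first generator is taken outside Phi(G) and the second outside the subgroup
    generated by Phi(G) and the first, which is proper since G is not cyclic. *)
Lemma two_generators_fix_or_inv (gT : finGroupType) (p : nat)
    (G : {group gT}) (t : gT) :
    prime p -> odd p -> p.-group G -> metacyclic G -> ~~ cyclic G ->
    t ^+ 2 = 1 -> t \in 'N(G) ->
  exists a b, [/\ <[a]> <*> <[b]> = G, a ^ t = a^-1 \/ a ^ t = a
                & b ^ t = b^-1 \/ b ^ t = b].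
Proof.
move=> p_pr odd_p pG metaG ncG t2 nGt.
have ntG : G :!=: 1 by apply: contraNneq ncG => ->; apply: cyclic1.
have /andP[sFG nFG] := Phi_normal G.
have [a /setDP[Ga notFa] a_t] :=
  invol_fix_or_inv_notin odd_p pG t2 nGt (Phi_proper ntG).
have prA : 'Phi(G) <*> <[a]> \proper G.
  rewrite properEneq join_subG sFG cycle_subG Ga !andbT.
  apply: contra ncG => /eqP/Phi_nongen <-.
  by rewrite genGid cycle_cyclic.
have [b /setDP[Gb notAb] b_t] := invol_fix_or_inv_notin odd_p pG t2 nGt prA.
exists a, b; split=> //.
set H := <[a]> <*> <[b]>.
(* Phi(G) < Phi(G) <a> < Phi(G) H, and Phi(G) has index at most p ^ 2. *)
suff defG : 'Phi(G) <*> H = G.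
  by rewrite -(Phi_nongen defG) genGid.
have sAH : 'Phi(G) <*> <[a]> \proper 'Phi(G) <*> H.
  rewrite properE join_subG joing_subl /=.
  rewrite (subset_trans (joing_subl <[a]> <[b]>)) ?joing_subr //=.
  apply: contra notAb => /subsetP-> //.
  by rewrite -cycle_subG (subset_trans (joing_subr <[a]> <[b]>)) ?joing_subr.
have sFA : 'Phi(G) \proper 'Phi(G) <*> <[a]>.
  rewrite properE joing_subl; apply: contra notFa => /subsetP-> //.
  by rewrite -cycle_subG joing_subr.
have idx (K L : {group gT}) : K \proper L -> L \subset G -> p * #|K| <= #|L|.
  move=> prKL sLG; have sKL := proper_sub prKL.
  rewrite -(Lagrange sKL) mulnC leq_pmul2l ?cardG_gt0 //.
  have pLK : p.-nat #|L : K|.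
    exact: pnat_dvd (dvdn_indexg L K) (pgroupS sLG pG).
  have /p_natP[[|n] eq_n] := pLK; last first.
    by rewrite eq_n expnS leq_pmulr ?expn_gt0 ?prime_gt0.
  by rewrite properE sKL -indexg_eq1 eq_n expn0 in prKL.
have sFHG : 'Phi(G) <*> H \subset G by rewrite !join_subG !cycle_subG sFG Ga.
apply/eqP; rewrite eqEcard sFHG /=.
have := metacyclic_card_Phi p_pr pG metaG.
rewrite card_quotient // => le_p2; rewrite -(Lagrange sFG) mulnC.
apply: leq_trans (idx _ _ sAH sFHG).
apply: leq_trans (_ : p * (p * #|'Phi(G)|) <= _).
  by rewrite mulnA leq_mul.
by rewrite leq_mul // idx // (proper_sub prA).
Qed.

(** * Splitting metacyclic p-groups with an involutory automorphism *)

(** The generator of larger order has order the exponent of G, so it splits off. *)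
Lemma abelian_two_generated_split (gT : finGroupType) (p : nat)
    (G : {group gT}) (a b : gT) :
    p.-group G -> abelian G -> <[a]> <*> <[b]> = G -> split_metacyclic G.
Proof.
move=> pG cGG.
wlog le_ba : a b / #[b] %| #[a] => [IH defG|defG].
  have sabG : <[a]> <*> <[b]> \subset G by rewrite defG.
  move: sabG; rewrite join_subG !cycle_subG => /andP[Ga Gb].
  have /p_natP[i oi] := mem_p_elt pG Ga; have /p_natP[j oj] := mem_p_elt pG Gb.
  case/orP: (leq_total i j) => le_ij.
    by apply: (IH b a); rewrite ?oi ?oj ?dvdn_exp2l // joingC.
  by apply: (IH a b); rewrite ?oi ?oj ?dvdn_exp2l.
have sabG : <[a]> <*> <[b]> \subset G by rewrite defG.
move: sabG; rewrite join_subG !cycle_subG => /andP[Ga Gb].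
have naG : G \subset 'N(<[a]>).
  by rewrite cents_norm // centsC cycle_subG (subsetP cGG).
have oa : #[a] = exponent G.
  apply/eqP; rewrite eqn_dvd dvdn_exponent //=; apply/exponentP => g.
  rewrite -defG norm_joinEr ?cycle_subG ?(subsetP naG) //.
  case/mulsgP => _ _ /cycleP[i ->] /cycleP[j ->] ->.
  rewrite expgMn; last by apply: commuteX2; apply: (centsP cGG).
  have b_oa : b ^+ #[a] = 1 by apply/eqP; rewrite -order_dvdn.
  by rewrite -!expgM ![(_ * #[a])%N]mulnC !expgM expg_order b_oa !expg1n mulg1.
have /splitsP[K /complP[tiK defaK]] := abelian_splits Ga oa cGG.
have sdG : <[a]> ><| K = G.
  rewrite sdprodE // (subset_trans _ naG) // -defaK mulG_subr //.
exists <[a]>%G, K; split; rewrite ?cycle_cyclic // (isog_cyclic (sdprod_isog sdG)).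
rewrite /= -defG quotientYidl ?cycle_subG ?(subsetP naG) //.
by rewrite quotient_cyclic ?cycle_cyclic.
Qed.

(** The commutator z = [a, b] is fixed by t and central.  If z = c^p, with c inverted
    modulo G' = <[z]>, then applying t gives z^2 = k^p for some k in <[z]>; as p
    is odd, z itself lies in <[z ^+ p]>, which forces z = 1. *)
Lemma both_inverted_abelian (gT : finGroupType) (p : nat)
    (G : {group gT}) (t a b : gT) :
    prime p -> odd p -> p.-group G -> metacyclic G -> t ^+ 2 = 1 -> t \in 'N(G) ->
    <[a]> <*> <[b]> = G -> a ^ t = a^-1 -> b ^ t = b^-1 ->
  abelian G.
Proof.
move=> p_pr odd_p pG metaG t2 nGt defG a_t b_t.
have odd_elt y : y \in G -> odd #[y] := pgroup_odd_order odd_p pG.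
have sabG : <[a]> <*> <[b]> \subset G by rewrite defG.
move: sabG; rewrite join_subG !cycle_subG => /andP[Ga Gb].
have cycG' := metacyclic_cyclic_der1 metaG.
have nG't : t \in 'N(G^`(1)) by rewrite (subsetP (char_norms (der_char 1 G))).
set z := [~ a, b]; have defG' : G^`(1) = <[z]> by apply: der1_two_generated.
have Gz : z \in G by rewrite groupR.
have commE (x y : gT) : x ^ t = x^-1 -> y ^ t = y^-1 ->
  [~ x, y] ^ t = [~ x, y] ^ (y * x)^-1.
  move=> xt yt; rewrite conjRg xt yt !commgEl !conjgE !invgM !invgK !mulgA.
  by rewrite mulgK mulgV mul1g.
(* By commE, if t inverted z then so would (b a)^-1, which has odd order. *)
have z_t : z ^ t = z.
  have [zV | //] : z ^ t = z^-1 \/ z ^ t = z.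
    by apply: (involution_cyclic_pgroup odd_p (mem_p_elt pG Gz) t2); rewrite -defG'.
  suff -> : z = 1 by rewrite conj1g.
  apply: (@conj_inv_odd_eq1 _ (b * a)^-1).
  - by rewrite orderV odd_elt // groupM.
  - exact: odd_elt.
  by rewrite -/z -zV -commE.
have fixG' y : y \in G^`(1) -> y ^ t = y.
  by rewrite defG' => /cycleP[i ->]; rewrite conjXg z_t.
(* This applies to the generating pairs (a, b) and (a^-1, b): G' commutes with
   b a and b a^-1, hence with a^2. *)
have cG'ba (x y : gT) : <[x]> <*> <[y]> = G -> x ^ t = x^-1 -> y ^ t = y^-1 ->
  x \in G -> y \in G -> y * x \in 'C(G^`(1)).
  move=> defGxy xt yt Gx Gy; rewrite (der1_two_generated defGxy cycG') cent_cycle.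
  rewrite -groupV; apply/cent1P/commute_sym/commgP/conjg_fixP.
  by rewrite -commE // fixG' // mem_commg.
have c1 := cG'ba a b defG a_t b_t Ga Gb.
have c2 : b * a^-1 \in 'C(G^`(1)).
  by apply: cG'ba; rewrite ?cycleV ?groupV // conjVg a_t.
have ca : a \in 'C(G^`(1)).
  apply: odd_sqr_mem (odd_elt a Ga) _.
  have -> : a ^+ 2 = (b * a^-1)^-1 * (b * a).
    by rewrite invgM invgK mulgA mulgKV.
  by rewrite groupM ?groupV.
have cb : b \in 'C(G^`(1)) by rewrite -(mulgK a b) groupM ?groupV.
have cGG' : G \subset 'C(G^`(1)) by rewrite -{1}defG join_subG !cycle_subG ca.
(* t inverts G / G', because it inverts generators of this abelian group. *)
have invG : {in G, forall y, y ^ t * y \in G^`(1)}.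
  pose H := [set y in G | y ^ t * y \in G^`(1)].
  have gH : group_set H.
    apply/group_setP; split=> [|x y].
      by rewrite inE group1 conj1g mulg1 group1.
    rewrite !inE => /andP[Gx Hx] /andP[Gy Hy]; rewrite groupM //=.
    have Gyt : y ^ t \in G by rewrite memJ_norm.
    have -> : (x * y) ^ t * (x * y) = x ^ t * x * [~ x, (y ^ t)^-1] * (y ^ t * y).
      rewrite conjMg commgEl; move: (x ^ t) (y ^ t) => v u.
      by rewrite conjgE invgK !mulgA mulgK mulgKV.
    by apply: groupM => //; apply: groupM => //; rewrite mem_commg ?groupV.
  suff sGH : G \subset Group gH.
    by move=> y /(subsetP sGH); rewrite inE => /andP[].
  by rewrite -{1}defG join_subG !cycle_subG !inE Ga Gb a_t b_t !mulVg group1.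
have [c Gc zc] : exists2 c, c \in G & z = c ^+ p.
  by apply: (metacyclic_der1_expg p_pr pG metaG); rewrite defG' cycle_id.
have [i ki] : exists i, c ^ t * c = z ^+ i by apply/cycleP; rewrite -defG' invG.
have cz y : y \in G -> commute z y.
  move=> Gy; apply/commute_sym/(centP (subsetP cGG' y Gy)).
  by rewrite defG' cycle_id.
(* Here z = z ^ t = (c ^ t) ^+ p = (z ^+ i * c^-1) ^+ p with z central. *)
have z2 : z ^+ 2 = z ^+ (i * p).
  have : z = (c ^ t) ^+ p by rewrite -conjXg -zc z_t.
  have -> : c ^ t = z ^+ i * c^-1 by rewrite -ki mulgK.
  rewrite expgMn; last by apply/commute_sym/commuteX/commute_sym/cz; rewrite groupV.
  by rewrite expgVn -zc -expgM => eq_z; rewrite expgS expg1 {1}eq_z mulgKV.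
have sz : <[z]> \subset <[z ^+ p]>.
  rewrite cycle_subG; apply: odd_sqr_mem (odd_elt z Gz) _.
  by rewrite z2 mulnC expgM mem_cycle.
have z1 : z = 1.
  apply/eqP; rewrite -order_eq1; apply: contraTT (subset_leq_card sz) => nt_z.
  have /p_natP[[|n] oz] := mem_p_elt pG Gz; first by rewrite oz in nt_z.
  rewrite -!orderE orderXdiv oz expnS ?dvdn_mulr // mulKn ?prime_gt0 // -ltnNge.
  by rewrite ltn_Pmull ?prime_gt1 ?expn_gt0 ?prime_gt0.
by rewrite (sameP derG1P eqP) defG' z1 cycle1.
Qed.

(** The inverted normal subgroup M = <[a]> G' is abelian and G = M ><| <[w]>.  The
    generator z = [a, w] of G' is a p-th power (m u)^p with m in M and u in <[w]>,
    which is u^p modulo Phi(M); thus u^p is in M, so u^p = 1 and z is in Phi(M).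
    Hence M = <[a]>. *)
Lemma inverted_fixed_split (gT : finGroupType) (p : nat)
    (G : {group gT}) (t a w : gT) :
    prime p -> odd p -> p.-group G -> metacyclic G -> t ^+ 2 = 1 -> t \in 'N(G) ->
    <[a]> <*> <[w]> = G -> a ^ t = a^-1 -> w ^ t = w ->
  split_metacyclic G.
Proof.
move=> p_pr odd_p pG metaG t2 nGt defG a_t w_t.
have odd_elt y : y \in G -> odd #[y] := pgroup_odd_order odd_p pG.
have sawG : <[a]> <*> <[w]> \subset G by rewrite defG.
move: sawG; rewrite join_subG !cycle_subG => /andP[Ga Gw].
have cycG' := metacyclic_cyclic_der1 metaG.
have nG't : t \in 'N(G^`(1)) by rewrite (subsetP (char_norms (der_char 1 G))).
set z := [~ a, w]; have defG' : G^`(1) = <[z]> by apply: der1_two_generated.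
have Gz : z \in G by rewrite groupR.
have zt_conj : z ^ t = (z ^ a^-1)^-1.
  by rewrite conjRg a_t w_t /z !commgEl !conjgE !invgM !invgK !mulgA mulgK.
have z_t : z ^ t = z^-1.
  have [// | zt] : z ^ t = z^-1 \/ z ^ t = z.
    by apply: (involution_cyclic_pgroup odd_p (mem_p_elt pG Gz) t2); rewrite -defG'.
  suff -> : z = 1 by rewrite conj1g invg1.
  apply: (@conj_inv_odd_eq1 _ a^-1).
  - by rewrite orderV odd_elt.
  - exact: odd_elt.
  - by rewrite -{2}zt zt_conj invgK.
have cza : commute a z.
  have za : z ^ a^-1 = z by apply: invg_inj; rewrite -zt_conj z_t.
  by rewrite -[a]invgK; apply/commute_sym/commuteV/commgP/conjg_fixP.
pose M := (<[a]> <*> <[z]>)%G.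
have abM : abelian M.
  rewrite abelianY !cycle_abelian cent_cycle cycle_subG.
  exact/cent1P/commute_sym.
have sMG : M \subset G by rewrite join_subG !cycle_subG Ga.
have sG'M : G^`(1) \subset M by rewrite defG' joing_subr.
have nsMG : M <| G by apply: sub_der1_normal.
have invM m : m \in M -> m ^ t = m^-1.
  rewrite /= cent_joinEl; last by rewrite cent_cycle cycle_subG; apply/cent1P.
  case/mulsgP=> _ _ /cycleP[i ->] /cycleP[j ->] ->.
  rewrite conjMg !conjXg a_t z_t !expgVn -invgM; congr _^-1.
  exact/commute_sym/commuteX2.
have tiMw : M :&: <[w]> = 1.
  apply/trivgP/subsetP => y /setIP[My /cycleP[i def_y]]; apply/set1P.
  apply: sqr_eq1_odd; first by rewrite odd_elt ?(subsetP sMG).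
  by rewrite -invM // def_y conjXg w_t.
have nMw : <[w]> \subset 'N(M) by rewrite cycle_subG (subsetP (normal_norm nsMG)).
have defMw : M * <[w]> = G.
  apply/eqP; rewrite eqEsubset mul_subG ?cycle_subG //=.
  rewrite -norm_joinEr // -{1}defG.
  by rewrite genS // setSU // joing_subl.
exists M, <[w]>%G; split; rewrite ?cycle_cyclic //; last by rewrite sdprodE.
(* M is generated by a and z, so it is cyclic once z is a nongenerator. *)
suff Fz : z \in 'Phi(M).
  suff -> : M :=: <[a]> by apply: cycle_cyclic.
  rewrite -[<[a]>]genGid; apply/esym/Phi_nongen/eqP.
  rewrite eqEsubset !join_subG Phi_sub joing_subl /=.
  by rewrite joing_subr cycle_subG (subsetP (joing_subl _ _)).
have nFG : G \subset 'N('Phi(M)).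
  by rewrite (char_norm_trans (Phi_char M)) ?normal_norm.
have pM : p.-group M := pgroupS sMG pG.
have [abMb expM] := abelemP p_pr (Phi_quotient_abelem pM).
have [c Gc zc] : exists2 c, c \in G & z = c ^+ p.
  by apply: (metacyclic_der1_expg p_pr pG metaG); rewrite defG' cycle_id.
move: Gc zc; rewrite -{1}defMw => /mulsgP[m u Mm wu ->] zc.
have [Gm Gu] : m \in G /\ u \in G.
  by rewrite (subsetP sMG) //; split=> //; rewrite (subsetP _ u wu) ?cycle_subG.
(* Modulo Phi(M), z is central of order dividing p, the class is at most 2, and
   (m u) ^+ p = m ^+ p * u ^+ p = u ^+ p. *)
pose f := coset 'Phi(M).
have fz : f z ^+ p = 1 by rewrite expM // mem_quotient // -cycle_subG joing_subr.
have [nFz nFm nFu] : [/\ z \in 'N('Phi(M)), m \in 'N('Phi(M)) & u \in 'N('Phi(M))].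
  by rewrite !(subsetP nFG).
have cfz y : y \in G -> commute (f y) (f z).
  move=> Gy; apply/cent1P; apply: subsetP (mem_quotient 'Phi(M) Gy).
  apply: (prime_order_normal_central p_pr); rewrite ?quotient_pgroup ?mem_quotient //.
  by rewrite -quotient_cycle // quotient_norms // -defG' der_norm.
have [i fR] : exists i, [~ f u, f m] = f z ^+ i.
  apply/cycleP; rewrite -quotient_cycle // -defG' -morphR //.
  by rewrite mem_quotient // mem_commg.
have fzu : f z = f u ^+ p.
  rewrite {1}zc [f _]morphX ?groupM // [coset_morphism _ _]morphM // -!/(f _).
  rewrite expMg_Rmul; last 2 first.
  - by rewrite fR; apply/commuteX/cfz.
  - by rewrite fR; apply/commuteX/cfz.
  rewrite expM ?mem_quotient // mul1g fR -expgM mulnC bin2odd // -!mulnA expgM.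
  by rewrite fz expg1n mulg1.
have Fzu : z * (u ^+ p)^-1 \in 'Phi(M).
  apply: coset_idr; first by rewrite groupM ?groupV ?groupX.
  rewrite [coset _ _]morphM ?groupV ?groupX //.
  rewrite [coset_morphism _ _^-1]morphV ?groupX //.
  rewrite [coset_morphism _ (u ^+ p)]morphX //.
  by apply/eqP; rewrite -eq_mulgV1; apply/eqP.
(* u ^+ p = 1, because u is in <[w]> while z and Phi(M) are in M. *)
have Mup : u ^+ p \in M :&: <[w]>.
  apply/setIP; split; last exact: groupX.
  rewrite -groupV -(mulKg z (_^-1)) groupM //.
    by rewrite groupV -cycle_subG joing_subr.
  exact: subsetP (Phi_sub M) _ Fzu.
by move: Fzu; rewrite tiMw in Mup; rewrite (set1P Mup) invg1 mulg1.
Qed.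

Lemma metacyclic_involution_split (gT : finGroupType) (p : nat)
    (G : {group gT}) (t : gT) :
    prime p -> odd p -> p.-group G -> metacyclic G -> t ^+ 2 = 1 ->
    t \in 'N(G) -> t \notin 'C(G) ->
  split_metacyclic G.
Proof.
move=> p_pr odd_p pG metaG t2 nGt notCt.
have [cycG | ncG] := boolP (cyclic G).
  by exists G, 1%G; split; rewrite ?cyclic1 // sdprodg1.
have [a [b [defG a_t b_t]]] :=
  two_generators_fix_or_inv p_pr odd_p pG metaG ncG t2 nGt.
case: a_t => a_t; case: b_t => b_t.
- have abG := both_inverted_abelian p_pr odd_p pG metaG t2 nGt defG a_t b_t.
  exact: abelian_two_generated_split pG abG defG.
- exact: (inverted_fixed_split p_pr odd_p pG metaG t2 nGt defG a_t b_t).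
- apply: (inverted_fixed_split p_pr odd_p pG metaG t2 nGt _ b_t a_t).
  by rewrite joingC.
have fixed_cent y : y ^ t = y -> y \in 'C[t].
  by move=> yt; apply/cent1P/commgP/conjg_fixP.
case/negP: notCt; rewrite -sub_cent1 -defG join_subG !cycle_subG.
by rewrite !fixed_cent.
Qed.

Lemma injm_split_metacyclic (aT rT : finGroupType) (D G : {group aT})
    (f : {morphism D >-> rT}) :
    'injm f -> G \subset D -> split_metacyclic G ->
  split_metacyclic (f @* G).
Proof.
move=> injf sGD [C [K [cycC cycK defG]]].
exists (f @* C)%G, (f @* K)%G; rewrite !morphim_cyclic //; split=> //.
exact: injm_sdprod.
Qed.

(** * Regular groups of automorphisms containing the right translations *)

(** The map s |-> c s^-1 c is how an automorphism commuting with the right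
    translations and exchanging the layers acts on the connection set.  It sends
    the elements of N, of which there are at least two, to a single coset of N,
    which must be N; so c^2 and c are in N, and x is sent to the coset of x^-1,
    which is neither N nor that of x. *)
Lemma haar_set_not_twist_stable (gT : finGroupType) (N : {group gT}) (x c : gT) :
    N <| [set: gT] -> odd #|[set: gT]| -> N :!=: 1 -> x \notin N ->
  ~ {in N :|: [set x], forall s, c * s^-1 * c \in N :|: [set x]}.
Proof.
move=> nsNG oddG ntN notNx stabS.
have odd_elt (y : gT) : odd #[y] by exact: dvdn_odd (order_dvdG (in_setT y)) oddG.
have nN y : y \in 'N(N) by apply: (subsetP (normal_norm nsNG)); rewrite inE.
have inS y : (y \in N :|: [set x]) = (y \in N) || (y == x) by rewrite !inE.
have Nc : c \in N.
  apply: odd_sqr_mem => //; have := stabS 1; rewrite !inS group1 invg1 mulg1.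
  move=> /(_ isT)/orP[// | /eqP cc].
  have [n Nn nt_n] : exists2 n, n \in N & n != 1 by apply/trivgPn.
  have := stabS n; rewrite !inS Nn => /(_ isT)/orP[Ncnc | /eqP].
    case/negP: notNx; rewrite -cc.
    have -> : c * c = c * n^-1 * c * n ^ c by rewrite conjgE !mulgA mulgK mulgKV.
    by rewrite groupM // memJ_norm.
  rewrite -cc => /mulIg/(canRL (mulKg _)); rewrite mulVg => /(canRL invgK) n1.
  by rewrite n1 invg1 eqxx in nt_n.
have := stabS x; rewrite !inS eqxx orbT => /(_ isT)/orP[Ncxc | /eqP cxc].
  case/negP: notNx; rewrite -groupV.
  by move: Ncxc; rewrite groupMr // groupMl.
case/negP: notNx; apply: odd_sqr_mem => //.
rewrite expgS expg1 -{1}cxc -mulgA.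
have -> : c * x^-1 * (c * x) = c * c ^ x by rewrite conjgE !mulgA.
by rewrite groupM // memJ_norm.
Qed.

Canonical right_transl_morphism (gT : finGroupType) :=
  @Morphism _ _ [set: gT] (@right_transl gT) (in2W (@right_translM gT)).

Lemma right_translE (gT : finGroupType) (g y : gT) (i : bool) :
  right_transl g (y, i) = (y * g, i).
Proof. by rewrite permE. Qed.

Lemma right_transl_injm (gT : finGroupType) : 'injm (@right_transl gT).
Proof.
apply/injmP => g h _ _ /permP/(_ (1, false)).
by rewrite !right_translE !mul1g => -[].
Qed.

Lemma morphim_right_transl (gT : finGroupType) :
  right_transl_morphism gT @* [set: gT] = right_transls gT.
Proof.
rewrite morphimEdom; apply/setP=> s.
by apply/imsetP/imsetP=> -[g _ ->]; exists g; rewrite ?inE.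
Qed.

Lemma not_algebraically_cayley (gT : finGroupType) (p : nat) (N : {group gT})
    (x : gT) :
    prime p -> odd p -> p.-group [set: gT] -> nonsplit_metacyclic [set: gT]%G ->
    #|[set: gT] : N| = p -> x \notin N ->
  ~ algebraically_cayley (N :|: [set x]).
Proof.
move=> p_pr odd_p pG [metaG nspG] indexN notNx [A [sAaut sRA [trA regA]]].
set R := right_transls_group gT in sRA.
have oddG : odd #|[set: gT]|.
  by have /p_natP[n ->] := pG; rewrite oddX odd_p orbT.
have maxN : maximal N [set: gT] by rewrite p_index_maximal ?subsetT ?indexN.
have nsN : N <| [set: gT] := p_maximal_normal pG maxN.
have ntN : N :!=: 1.
  apply: contra_notN nspG => /eqP N1.
  have cycG : cyclic [set: gT] by rewrite prime_cyclic // -indexg1 -N1 indexN.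
  by exists [set: gT]%G, 1%G; rewrite cycG cyclic1 sdprodg1.
have isoR : right_transl_morphism gT @* [set: gT] = R.
  by apply: morphim_right_transl.
have oR : #|R| = #|[set: gT]| by rewrite -isoR card_injm ?right_transl_injm.
have oA : #|A| = (#|[set: gT]| * 2)%N.
  rewrite -(card_orbit_stab 'P A (1, false)) regA cards1 muln1.
  by rewrite (atransP trA) ?inE // cardsT card_prod card_bool cardsT.
have indexR : #|A : R| = 2.
  by rewrite -divgS // oR oA mulKn // cardG_gt0.
have nRA := normal_norm (index2_normal sRA indexR).
have [t At ot] : {t | t \in A & #[t] = 2} by apply: Cauchy; rewrite // oA dvdn_mull.
have t2 : t ^+ 2 = 1 by rewrite -ot expg_order.
have notRt : t \notin R.
  by apply: contraL oddG => /order_dvdG; rewrite ot oR dvdn2.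
have cRt : t \in 'C(R).
  apply: contra_notT nspG => notCt.
  have pR : p.-group R by rewrite /pgroup oR.
  have metaR : metacyclic R by rewrite -isoR morphim_metacyclic.
  have [C [K [cycC cycK defR]]] := metacyclic_involution_split p_pr odd_p pR
    metaR t2 (subsetP nRA t At) notCt.
  pose f := invm_morphism (@right_transl_injm gT).
  have <- : (f @* R)%G = [set: gT]%G.
    by apply: val_inj; rewrite /= -isoR morphim_invm.
  apply: injm_split_metacyclic; rewrite ?injm_invm //= ?isoR //.
  by exists C, K.
have ttK : involutive t by move=> u; rewrite -permM -[t * t]/(t ^+ 2) t2 perm1.
have tR g u : t (right_transl g u) = right_transl g (t u).
  rewrite -!permM; congr (fun_of_perm _ _); apply/commute_sym/(centP cRt).
  by rewrite -isoR mem_morphim ?inE.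
(* t exchanges the layers: otherwise it agrees at (1, false) with a right
   translation, to which it is equal by regularity. *)
have [c tc] : exists c, t (1, false) = (c, true).
  case E: (t (1, false)) => [c []]; first by exists c.
  case/negP: notRt; suff -> : t = right_transl c by apply: imset_f.
  have Ac : right_transl c \in A by apply/(subsetP sRA)/imset_f.
  have : t * (right_transl c)^-1 \in 'C_A[(1, false) | 'P].
    apply/setIP; split; first by rewrite groupM ?groupV.
    apply/astab1P.
    rewrite /= apermE permM E; apply: (canLR (permK _)).
    by rewrite right_translE mul1g.
  by rewrite regA => /set1P/eqP; rewrite -eq_mulgV1 => /eqP.
have tF : t (c, true) = (1, false) by rewrite -tc ttK.
apply: (@haar_set_not_twist_stable _ N x c) => // s Ss.
have /graph_AutP e_t := subsetP sAaut t At.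
have := e_t (1, false) (s, true).
have -> : t (s, true) = (c^-1 * s, false).
  by rewrite -{1}(mulKVg c s) -(right_translE _ c) tR tF right_translE mul1g.
have -> : haar_edge (N :|: [set x]) (1, false) (s, true).
  by apply/orP; left; apply/existsP; exists s; rewrite Ss mulg1 eqxx.
rewrite tc /haar_edge /haar_arc /= => /existsP[s' /andP[Ss' /eqP eq_c]].
suff -> : c * s^-1 * c = s' by [].
by rewrite -(mulgK (c^-1 * s) s') -eq_c invgM invgK mulgA.
Qed.

(** * The Haar graph as a Cayley graph of a dihedral group times N *)

Section GeneralizedDihedral.

Variables (qT : finGroupType) (abQ : abelian [set: qT]).

(** The generalised dihedral group of an abelian group; the boolean marks the
    elements that act on it by inversion.  The type depends on the proof of
    commutativity because associativity of the product does. *)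
Definition dih of abelian [set: qT] : Type := (qT * bool)%type.

HB.instance Definition _ := Finite.on (dih abQ).

Definition dih_mul (u v : dih abQ) : dih abQ :=
  (u.1 * (if u.2 then v.1^-1 else v.1), u.2 (+) v.2).
Definition dih_one : dih abQ := (1, false).
Definition dih_inv (u : dih abQ) : dih abQ :=
  (if u.2 then u.1 else u.1^-1, u.2).

Lemma dih_mulA : associative dih_mul.
Proof.
have qC (u v : qT) : u * v = v * u by apply: (centsP abQ); rewrite inE.
move=> [u i] [v j] [w k]; rewrite /dih_mul /= addbA; congr (_, _).
by case: i; case: j; rewrite /= ?invgM ?invgK -?mulgA // (qC v^-1).
Qed.

Lemma dih_mul1 : left_id dih_one dih_mul.
Proof. by move=> [u i]; rewrite /dih_mul /= mul1g. Qed.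

Lemma dih_mulV : left_inverse dih_one dih_inv dih_mul.
Proof.
by move=> [u i]; rewrite /dih_mul /dih_one addbb; case: i => /=; rewrite ?mulgV ?mulVg.
Qed.

HB.instance Definition _ :=
  Finite_isGroup.Build (dih abQ) dih_mulA dih_mul1 dih_mulV.

End GeneralizedDihedral.

Lemma cayley_edge_sym (aT : finGroupType) (T : {set aT}) (u v : aT) :
  T^-1 = T -> cayley_edge T u v = cayley_edge T v u.
Proof.
move=> TV; suff sub u' v' : cayley_edge T u' v' -> cayley_edge T v' u'.
  by apply/idP/idP; apply: sub.
case/existsP=> s /andP[Ts /eqP->]; apply/existsP; exists s^-1.
by rewrite mulKg eqxx andbT -TV memV_invg.
Qed.

Lemma cayley_edgeE (aT : finGroupType) (T : {set aT}) (u v : aT) :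
  cayley_edge T u v = (v * u^-1 \in T).
Proof.
apply/existsP/idP => [[s /andP[Ts /eqP->]] | Tuv]; first by rewrite mulgK.
by exists (v * u^-1); rewrite Tuv mulgKV eqxx.
Qed.

Lemma haar_arcE (gT : finGroupType) (S : {set gT}) (g h : gT) :
  haar_arc S (g, false) (h, true) = (h * g^-1 \in S).
Proof.
rewrite /haar_arc /=; apply/existsP/idP => [[s /andP[Ss /eqP->]] | Sgh].
  by rewrite mulgK.
by exists (h * g^-1); rewrite Sgh mulgKV eqxx.
Qed.

(** The first layer is mapped to the rotations and the second to the reflections of
    the dihedral group on G / N; the label of y in N is y times the inverse of the
    chosen representative of its coset. *)
Lemma haar_cayley (gT : finGroupType) (N : {group gT}) (x : gT) :
    N <| [set: gT] -> abelian ([set: gT] / N) ->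
  is_cayley_graph (haar_edge (N :|: [set x])).
Proof.
move=> nsN abQ.
have nN y : y \in 'N(N) by apply: (subsetP (normal_norm nsN)); rewrite inE.
have abQT : abelian [set: coset_of N].
  suff <- : [set: gT] / N = [set: coset_of N] by [].
  by apply/setP=> q; have [y _ ->] := cosetP q; rewrite mem_quotient inE.
have QC (q q' : coset_of N) : q * q' = q' * q by apply: (centsP abQT); rewrite inE.
have cosetM y z : coset N (y * z) = coset N y * coset N z by rewrite morphM.
have cosetV y : coset N y^-1 = (coset N y)^-1 by rewrite morphV.
have cosetE y z : (coset N y == coset N z) = (y * z^-1 \in N).
  rewrite eq_mulgV1 -cosetV -cosetM.
  by apply/eqP/idP => [/coset_idr -> | /coset_id].
pose r y := y * (repr (coset N y))^-1.
have Nr y : r y \in N by rewrite -cosetE coset_reprK.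
pose aT : finGroupType := (dih abQT * subg_of N)%type.
(* The reflection at the coset of x with every label in N, and the reflection
   at the trivial coset with the trivial label. *)
pose T : {set aT} := [set z : aT | z.1.2 &&
  ((z.1.1 == coset N x) || (z.1.1 == 1) && (z.2 == 1))].
(* On the second layer the labels are shifted by x^-1, so that the edge from
   (g, false) to (x g, true) preserves them. *)
pose phi (u : gT * bool) : aT :=
  if u.2 then (((coset N (x^-1 * u.1))^-1, true) , subg N (r (x^-1 * u.1)))
  else ((coset N u.1, false), subg N (r u.1)).
pose glue (q : coset_of N) (n : subg_of N) := sgval n * repr q.
pose psi (z : aT) : gT * bool :=
  if z.1.2 then (x * glue z.1.1^-1 z.2, true)
  else (glue z.1.1 z.2, false).
have rK y : glue (coset N y) (subg N (r y)) = y.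
  by rewrite /glue subgK // mulgKV.
have coset_glue q n : coset N (glue q n) = q.
  by rewrite cosetM coset_reprK coset_id ?mul1g // subgP.
have r_glue q n : subg N (r (glue q n)) = n.
  by rewrite /r coset_glue mulgK sgvalK.
have bij_phi : bijective phi.
  exists psi => [[y []] | [[q []] n]]; rewrite /phi /psi /=.
  - by rewrite invgK rK mulKVg.
  - by rewrite rK.
  - by rewrite mulKg coset_glue r_glue invgK.
  - by rewrite coset_glue r_glue.
have TV : T^-1 = T.
  apply/setP=> -[[q i] n]; rewrite inE.
  have -> : (((q, i), n) : aT)^-1 = ((if i then q else q^-1, i), n^-1) by [].
  by rewrite !inE /= invg_eq1; case: i.
have arcE g h : cayley_edge T (phi (g, false)) (phi (h, true)) =
    haar_arc (N :|: [set x]) (g, false) (h, true).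
  rewrite cayley_edgeE haar_arcE inE /= !inE; congr (_ || _).
    rewrite invgK cosetM cosetV invgM invgK (QC _ (coset N x)) -mulgA.
    by rewrite -[X in _ == X]mulg1 (inj_eq (mulgI _)) -eq_invg_mul invgK cosetE.
  rewrite -(eq_mulgV1 (subg N _)) -eq_mulgV1 (inj_eq invg_inj).
  apply/andP/eqP => [[/eqP eq_coset /eqP eq_r] | <-].
    by rewrite -(rK g) -eq_coset -eq_r rK invgM invgK mulKVg.
  by rewrite invgM invgK mulgKV.
exists aT, T; split=> //; first by rewrite inE.
exists phi => // -[g i] [h j]; case: i; case: j.
- by rewrite cayley_edgeE inE.
- by rewrite cayley_edge_sym // arcE.
- by rewrite arcE /haar_edge orbF.
- by rewrite cayley_edgeE inE.
Qed.

Theorem proposition4 (p : nat) (gT : finGroupType) (N : {group gT}) (x : gT)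
    (p_prime : prime p) (p_odd : odd p)
    (pG : p.-group [set: gT])
    (nsG : nonsplit_metacyclic [set: gT]%G)
    (indexN : #|[set: gT] : N| = p)
    (xN : x \notin N) :
  is_cayley_graph (haar_edge (N :|: [set x])) /\
  ~ algebraically_cayley (N :|: [set x]).
Proof.
have maxN : maximal N [set: gT] by rewrite p_index_maximal ?subsetT ?indexN.
have nsN : N <| [set: gT] := p_maximal_normal pG maxN.
split; last exact: not_algebraically_cayley p_prime p_odd pG nsG indexN xN.
apply: haar_cayley => //; apply/cyclic_abelian/prime_cyclic.
by rewrite card_quotient ?normal_norm // indexN.
Qed.
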